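(* Let $(\boldsymbol{\rho},\lambda')$ be a rigid origami. (1) If it is first-order rigid or statically rigid, then it is prestress stable. (2) If it is prestress stable, then it is second-order rigid. (3) If it is second-order rigid, then it is rigid.
   Context: Rigid origami. A rigid origami consists of rigid planar polygonal panels hinged along $N_c$ inner creases, with $N_v$ inner vertices and $N_h$ holes (a hole is represented by a closed cycle of panels and inner creases around its boundary; $N_h$ is the first Betti number). Its state is given by the folding angles $\boldsymbol{\rho}=(\rho_1,\dots,\rho_{N_c})\in(-\pi,\pi)^{N_c}$, one for each inner crease; all lengths and angles within panels (e.g. the sector angles $\alpha\in(0,2\pi)$ between adjacent creases of a panel) are fixed. $\lambda'$ is an order function recording the stacking of panels; collisions and self-intersection of panels are not considered, so $\lambda'$ plays no role in the definitions below. Consistency constraint. Let $R_z(\theta),R_x(\theta)$ be the $3\times3$ rotation matrices by angle $\theta$ about the $z$- and $x$-axis. Around an inner vertex with incident creases cyclically numbered $1,\dots,n$, the constraint is $R(\boldsymbol{\rho})=\prod_{j=1}^n R_z(\alpha_j)R_x(\rho_j)=I$ (factors ordered left to right), with $\alpha_j$ the sector angle between creases $j-1$ and $j$ (indices cyclic). Around a hole with incident creases $1,\dots,n$ it is $T(\boldsymbol{\rho})=\prod_{j=1}^n \begin{pmatrix}R_z(\beta_j)&v_j\\0&1\end{pmatrix}\begin{pmatrix}R_x(\rho_j)&0\\0&1\end{pmatrix}=I$, where $\beta_j$ and $v_j=(l_j\cos\gamma_j,l_j\sin\gamma_j,0)^T$ are fixed geometric constants (relative rotation and translation of the consecutive panel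 frames). The state $\boldsymbol{\rho}$ satisfies all these constraints. Independent components. Express $R$ and $T$ in one global coordinate system: conjugate $R$ by the orthogonal matrix, respectively $T$ by the rigid motion, given by the frame of panel $n$ at the given state (kept constant). Put $(A_1,A_2,A_3)=(R_{32},R_{13},R_{21})$ for each vertex; for each hole put $(A_1,A_2,A_3)=(T_{32},T_{13},T_{21})$ and $(A_4,A_5,A_6)=(T_{14},T_{24},T_{34})$. Collecting all of them gives $\boldsymbol{A}(\boldsymbol{\rho})\in\mathbb{R}^{m}$, $m=3N_v+6N_h$. The derivatives below are evaluated at the given state: $M=\mathrm{d}\boldsymbol{A}/\mathrm{d}\boldsymbol{\rho}$ is the $m\times N_c$ rigidity matrix, and for a row vector $\boldsymbol{\omega}\in\mathbb{R}^m$, $\boldsymbol{\omega}\cdot\mathrm{d}^2\boldsymbol{A}/\mathrm{d}\boldsymbol{\rho}^2=\sum_i\omega_i\,\mathrm{d}^2A_i/\mathrm{d}\boldsymbol{\rho}^2$ is a symmetric $N_c\times N_c$ matrix. Definitions. - First-order rigid: $M\boldsymbol{\rho}'=\boldsymbol{0}$ only for $\boldsymbol{\rho}'=\boldsymbol{0}$. - Statically rigid: for every load (row vector) $\boldsymbol{l}\in\mathbb{R}^{N_c}$ there is a row vector $\boldsymbol{\omega}\in\mathbb{R}^m$ with $\boldsymbol{\omega}M=\boldsymbol{l}$. - Prestress stable: there are a (symmetric) positive-definite $m\times m$ matrix $B$ and a row vector $\boldsymbol{\omega}_s\in\mathbb{R}^m$ with $\boldsymbol{\omega}_sM=\boldsymbol{0}$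 such that $K=M^TBM+\boldsymbol{\omega}_s\cdot\mathrm{d}^2\boldsymbol{A}/\mathrm{d}\boldsymbol{\rho}^2$ is positive-definite. - A second-order flex is a pair $(\boldsymbol{\rho}',\boldsymbol{\rho}'')\in\mathbb{R}^{N_c}\times\mathbb{R}^{N_c}$ with $M\boldsymbol{\rho}'=\boldsymbol{0}$ and $\boldsymbol{\rho}'^T(\mathrm{d}^2\boldsymbol{A}/\mathrm{d}\boldsymbol{\rho}^2)\boldsymbol{\rho}'+M\boldsymbol{\rho}''=\boldsymbol{0}$, where the $i$-th component of the first term is $\boldsymbol{\rho}'^T(\mathrm{d}^2A_i/\mathrm{d}\boldsymbol{\rho}^2)\boldsymbol{\rho}'$. It is trivial if $\boldsymbol{\rho}'=\boldsymbol{0}$. Second-order rigid: every second-order flex is trivial. - Rigid-foldable: there is a non-constant continuous path of folding angles, starting at $\boldsymbol{\rho}$, along which all the consistency constraints ($R=I$ at every inner vertex, $T=I$ at every hole) hold. Rigid: not rigid-foldable. *)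

(* Defs.v *)
From mathcomp Require Import all_boot all_order all_algebra.
From mathcomp Require Import all_classical all_reals all_analysis.
Set Implicit Arguments.
Unset Strict Implicit.
Unset Printing Implicit Defensive.
Import Order.TTheory GRing.Theory Num.Theory.
Import numFieldNormedType.Exports.
Local Open Scope classical_set_scope.
Local Open Scope ring_scope.

Definition i0 : 'I_3 := @Ordinal 3 0 isT.
Definition i1 : 'I_3 := @Ordinal 3 1 isT.
Definition i2 : 'I_3 := @Ordinal 3 2 isT.

Definition Rz (R : realType) (t : R) : 'M[R]_3 :=
  \matrix_(i, j) nth 0 (nth [::] [:: [:: cos t; - sin t; 0];
                                     [:: sin t;   cos t; 0];
                                     [::     0;       0; 1]] i) j.

Definition Rx (R : realType) (t : R) : 'M[R]_3 :=
  \matrix_(i, j) nth 0 (nth [::] [:: [:: 1;     0;       0];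
                                     [:: 0; cos t; - sin t];
                                     [:: 0; sin t;   cos t]] i) j.

(* The affine map x |-> Q x + v in homogeneous coordinates. *)
Definition hom (R : realType) (Q : 'M[R]_3) (v : 'cV[R]_3) : 'M[R]_(3 + 1) :=
  block_mx Q v 0 1%:M.

Definition planar_vec (R : realType) (l g : R) : 'cV[R]_3 :=
  \col_i nth 0 [:: l * cos g; l * sin g; 0] i.

(* F is the right-handed orthonormal frame with x-axis x and z-axis z; its
   columns are the axes in global coordinates. *)
Definition is_frame (R : realType) (F : 'M[R]_3) (x z : 'cV[R]_3) : Prop :=
  [/\ F *m F^T = 1%:M, \det F = 1, col i0 F = x & col i2 F = z].

(* A dart is the crossing of an inner crease c in one of the two directions:
   (c, true) goes from panel [src c] to panel [dst c], (c, false) back. *)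
Definition dart (nc : nat) : Type := ('I_nc * bool)%type.

Definition dart_from (nc np : nat) (src dst : 'I_nc -> 'I_np) (d : dart nc) :=
  if d.2 then src d.1 else dst d.1.

Definition dart_to (nc np : nat) (src dst : 'I_nc -> 'I_np) (d : dart nc) :=
  if d.2 then dst d.1 else src d.1.

Definition closed_cycle (nc np : nat) (src dst : 'I_nc -> 'I_np) (n : nat)
    (w : 'I_n -> dart nc) : Prop :=
  forall j, dart_from src dst (w j) = dart_to src dst (w (ord_pred j)).

Definition crease_boundary (nc np : nat) (src dst : 'I_nc -> 'I_np) :
    'M[rat]_(nc, np) :=
  \matrix_(c, p) ((dst c == p)%:R - (src c == p)%:R).

Definition cycle_chains (nc k : nat) (sz : 'I_k -> nat)
    (w : forall a, 'I_(sz a).+1 -> dart nc) : 'M[rat]_(k, nc) :=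
  \matrix_(a, c) \sum_(j < (sz a).+1 | (w a j).1 == c) (-1) ^+ (~~ (w a j).2).

(* The paper is represented by its dual cell complex: 0-cells are the panels,
   1-cells the inner creases, 2-cells the inner vertices.  Then
   dim Z_1 = n_creases - rank (crease_boundary), dim B_1 is the rank of the
   vertex cycles, and the first Betti number is dim Z_1 - dim B_1.

   The cycle around vertex v has (vertex_size v).+1 creases, listed as
   0, ..., vertex_size v instead of 1, ..., n; thus [ord_max] is crease n, and
   index j - 1 (cyclic) is [ord_pred j].  Likewise for holes. *)
Record crease_pattern (R : realType) := CreasePattern {
  n_panels : nat;
  n_creases : nat;
  n_vertices : nat;
  n_holes : nat;
  crease_src : 'I_n_creases -> 'I_n_panels;
  crease_dst : 'I_n_creases -> 'I_n_panels;
  vertex_size : 'I_n_vertices -> nat;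
  vertex_dart : forall v, 'I_(vertex_size v).+1 -> dart n_creases;
  sector_angle : forall v, 'I_(vertex_size v).+1 -> R;
  hole_size : 'I_n_holes -> nat;
  hole_dart : forall h, 'I_(hole_size h).+1 -> dart n_creases;
  hole_beta : forall h, 'I_(hole_size h).+1 -> R;
  hole_length : forall h, 'I_(hole_size h).+1 -> R;
  hole_gamma : forall h, 'I_(hole_size h).+1 -> R;
  vertex_closed : forall v, closed_cycle crease_src crease_dst (@vertex_dart v);
  vertex_creases_distinct : forall v, injective (fun j => (@vertex_dart v j).1);
  sector_angle_range : forall v j, 0 < @sector_angle v j < 2 * pi;
  hole_closed : forall h, closed_cycle crease_src crease_dst (@hole_dart h);
  holes_betti : n_holes =
    (n_creases - \rank (crease_boundary crease_src crease_dst)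
               - \rank (cycle_chains vertex_dart))%N;
  (* the hole cycles represent a basis of the first homology *)
  holes_generate :
    \rank (col_mx (cycle_chains vertex_dart) (cycle_chains hole_dart)) =
    (n_creases - \rank (crease_boundary crease_src crease_dst))%N
}.

Definition vertex_step (R : realType) (P : crease_pattern R)
    (x : 'cV[R]_(n_creases P)) (v : 'I_(n_vertices P))
    (j : 'I_(vertex_size v).+1) : 'M[R]_3 :=
  Rz (sector_angle j) *m Rx (x (vertex_dart j).1 0).

Definition hole_step (R : realType) (P : crease_pattern R)
    (x : 'cV[R]_(n_creases P)) (h : 'I_(n_holes P))
    (j : 'I_(hole_size h).+1) : 'M[R]_(3 + 1) :=
  hom (Rz (hole_beta j)) (planar_vec (hole_length j) (hole_gamma j)) *m
  hom (Rx (x (hole_dart j).1 0)) 0.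

Definition vertex_loop (R : realType) (P : crease_pattern R)
    (x : 'cV[R]_(n_creases P)) (v : 'I_(n_vertices P)) : 'M[R]_3 :=
  \big[mulmx/1%:M]_(j < (vertex_size v).+1) vertex_step x j.

Definition hole_loop (R : realType) (P : crease_pattern R)
    (x : 'cV[R]_(n_creases P)) (h : 'I_(n_holes P)) : 'M[R]_(3 + 1) :=
  \big[mulmx/1%:M]_(j < (hole_size h).+1) hole_step x j.

Definition consistent (R : realType) (P : crease_pattern R)
    (x : 'cV[R]_(n_creases P)) : Prop :=
  (forall v, vertex_loop x v = 1%:M) /\ (forall h, hole_loop x h = 1%:M).

Definition folding_angles (R : realType) (n : nat) (x : 'cV[R]_n) : Prop :=
  forall c, - pi < x c 0 < pi.

(* Direction of the x-axis when crossing a crease along a dart; crossing in the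
   opposite direction reverses it, which keeps the sign of the folding angle. *)
Definition dart_dir (R : realType) (nc : nat) (e : 'I_nc -> 'cV[R]_3)
    (d : dart nc) : 'cV[R]_3 :=
  (-1) ^+ (~~ d.2) *: e d.1.

(* A crease pattern placed in global coordinates at the state [rho].  The j-th
   frame of a cycle is attached to the panel entered after crossing its j-th
   crease, with x-axis along that crease and z-axis normal to the panel; for a
   hole its origin is a point of the line of that crease.  The stacking order
   of the panels is not represented. *)
Record rigid_origami (R : realType) := RigidOrigami {
  pattern :> crease_pattern R;
  rho : 'cV[R]_(n_creases pattern);
  panel_normal : 'I_(n_panels pattern) -> 'cV[R]_3;
  crease_dir : 'I_(n_creases pattern) -> 'cV[R]_3;
  crease_point : 'I_(n_creases pattern) -> 'cV[R]_3;
  vertex_frame : forall v : 'I_(n_vertices pattern),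
    'I_(vertex_size v).+1 -> 'M[R]_3;
  hole_frame : forall h : 'I_(n_holes pattern),
    'I_(hole_size h).+1 -> 'M[R]_3;
  hole_origin : forall h : 'I_(n_holes pattern),
    'I_(hole_size h).+1 -> 'cV[R]_3;
  rho_range : folding_angles rho;
  rho_consistent : consistent rho;
  vertex_frameP : forall v j,
    is_frame (@vertex_frame v j) (dart_dir crease_dir (vertex_dart j))
      (panel_normal (dart_to (@crease_src R pattern) (@crease_dst R pattern)
                       (vertex_dart j)));
  vertex_frame_step : forall v j,
    @vertex_frame v j = @vertex_frame v (ord_pred j) *m vertex_step rho j;
  hole_frameP : forall h j,
    is_frame (@hole_frame h j) (dart_dir crease_dir (hole_dart j))
      (panel_normal (dart_to (@crease_src R pattern) (@crease_dst R pattern)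
                       (hole_dart j)));
  hole_originP : forall h j, exists t : R,
    @hole_origin h j =
      crease_point (hole_dart j).1 + t *: crease_dir (hole_dart j).1;
  hole_frame_step : forall h j,
    hom (@hole_frame h j) (@hole_origin h j) =
      hom (@hole_frame h (ord_pred j)) (@hole_origin h (ord_pred j)) *m
      hole_step rho j
}.

(* Loop matrices in global coordinates: the conjugating frame is that of the
   last panel at the state [rho], and does not depend on x. *)
Definition vertex_loop_global (R : realType) (O : rigid_origami R)
    (x : 'cV[R]_(n_creases O)) (v : 'I_(n_vertices O)) : 'M[R]_3 :=
  let F := vertex_frame (ord_max : 'I_(vertex_size v).+1) in
  F *m vertex_loop x v *m invmx F.

Definition hole_loop_global (R : realType) (O : rigid_origami R)
    (x : 'cV[R]_(n_creases O)) (h : 'I_(n_holes O)) : 'M[R]_(3 + 1) :=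
  let j : 'I_(hole_size h).+1 := ord_max in
  let G := hom (hole_frame j) (hole_origin j) in
  G *m hole_loop x h *m invmx G.

Definition rot_entries (R : realType) (Q : 'M[R]_3) : seq R :=
  [:: Q i2 i1; Q i0 i2; Q i1 i0].

Definition hom_entries (R : realType) (T : 'M[R]_(3 + 1)) : seq R :=
  rot_entries (ulsubmx T) ++
  [:: ursubmx T i0 0; ursubmx T i1 0; ursubmx T i2 0].

Definition n_constraints (R : realType) (O : rigid_origami R) : nat :=
  (n_vertices O * 3 + n_holes O * 6)%N.

(* [mxvec] concatenates the rows: 3 entries per vertex, then 6 per hole. *)
Definition constraint_map (R : realType) (O : rigid_origami R)
    (x : 'cV[R]_(n_creases O)) : 'cV[R]_(n_constraints O) :=
  (row_mx
    (mxvec (\matrix_(v < n_vertices O, k < 3)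
              nth 0 (rot_entries (vertex_loop_global x v)) k))
    (mxvec (\matrix_(h < n_holes O, k < 6)
              nth 0 (hom_entries (hole_loop_global x h)) k)))^T.

Definition partial (R : realType) (n : nat) (f : 'cV[R]_n -> R) (k : 'I_n)
    (x : 'cV[R]_n) : R :=
  'D_(delta_mx k 0) f x.

Definition rigidity_matrix (R : realType) (O : rigid_origami R) :
    'M[R]_(n_constraints O, n_creases O) :=
  \matrix_(i, k) partial (fun x => constraint_map x i 0) k (rho O).

Definition hessian (R : realType) (O : rigid_origami R)
    (i : 'I_(n_constraints O)) : 'M[R]_(n_creases O) :=
  \matrix_(k, l)
    partial (partial (fun x => constraint_map x i 0) l) k (rho O).

Definition stress_hessian (R : realType) (O : rigid_origami R)
    (w : 'rV[R]_(n_constraints O)) : 'M[R]_(n_creases O) :=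
  \sum_i w 0 i *: hessian i.

Definition positive_definite (R : realType) (n : nat) (S : 'M[R]_n) : Prop :=
  S^T = S /\ forall x : 'cV[R]_n, x != 0 -> 0 < (x^T *m S *m x) 0 0.

Definition first_order_rigid (R : realType) (O : rigid_origami R) : Prop :=
  forall r1 : 'cV[R]_(n_creases O), rigidity_matrix O *m r1 = 0 -> r1 = 0.

Definition statically_rigid (R : realType) (O : rigid_origami R) : Prop :=
  forall l : 'rV[R]_(n_creases O),
    exists w : 'rV[R]_(n_constraints O), w *m rigidity_matrix O = l.

Definition prestress_stable (R : realType) (O : rigid_origami R) : Prop :=
  exists (B : 'M[R]_(n_constraints O)) (w : 'rV[R]_(n_constraints O)),
    [/\ positive_definite B,
        w *m rigidity_matrix O = 0 &
        positive_definite
          ((rigidity_matrix O)^T *m B *m rigidity_matrix O + stress_hessian w)].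

Definition second_order_flex (R : realType) (O : rigid_origami R)
    (r1 r2 : 'cV[R]_(n_creases O)) : Prop :=
  rigidity_matrix O *m r1 = 0 /\
  (\col_i (r1^T *m hessian i *m r1) 0 0) + rigidity_matrix O *m r2 = 0.

Definition second_order_rigid (R : realType) (O : rigid_origami R) : Prop :=
  forall r1 r2 : 'cV[R]_(n_creases O), second_order_flex r1 r2 -> r1 = 0.

Definition rigid_foldable (R : realType) (O : rigid_origami R) : Prop :=
  exists g : R -> 'cV[R]_(n_creases O),
    [/\ {within `[0, 1], continuous g},
        g 0 = rho O,
        forall t, 0 <= t <= 1 -> folding_angles (g t) /\ consistent (g t) &
        exists2 t, 0 <= t <= 1 & g t != g 0].

Definition rigid (R : realType) (O : rigid_origami R) : Prop :=
  ~ rigid_foldable O.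

(* Main.v *)
Require Import Defs.
From mathcomp Require Import all_boot all_order all_algebra.
From mathcomp Require Import all_classical all_reals all_analysis.
From mathcomp Require Import ring lra.

(** The implications (1) and (2) are linear algebra.  Static rigidity says that
    the rows of the rigidity matrix [M] span the whole space, hence that [M] is
    injective, which is first-order rigidity; then [M^T M] is positive definite,
    so the identity and the zero stress witness prestress stability.  If
    [r1, r2] is a second-order flex, pairing its second equation with a
    self-stress [w] kills [M r2], so both parts of the quadratic form of [K]
    vanish at [r1], and positivity of [K] forces [r1 = 0].

    The implication (3) needs more care because a folding path is only
    continuous: it has no derivatives to be used as a flex.  Instead the state
    [rho] is shown to be isolated in the level set of the constraint map [A]
    ([quadratic_isolation]).  If [A (rho + u) = A rho] with [u] small and
    nonzero, Taylor's formula gives [M u + q u / 2 = o(|u|^2)], where [q] is the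
    quadratic map of the Hessians.  For the unit vector [r] along [u] this makes
    [M r] small, and it makes [q r] close to the image of [M].  If these two
    quantities vanish at a unit vector [r], then [r] is the first component of
    a nontrivial second-order flex; so under second-order rigidity their sum is
    positive on the unit sphere and, by compactness, bounded below, which
    excludes small [u].  Since the distance to [rho] takes arbitrarily small
    positive values along a non-constant path ([continuous_escape]), such a path
    cannot exist.

    Taylor's formula is available because the entries of the loop matrices are
    polynomials in the sines and cosines of the folding angles
    ([twice_diff_constraint_map]). *)

Set Implicit Arguments.
Unset Strict Implicit.
Unset Printing Implicit Defensive.
Import Order.TTheory GRing.Theory Num.Theory.
Import numFieldNormedType.Exports.
Local Open Scope classical_set_scope.
Local Open Scope ring_scope.

(** * Norm and continuity of matrices *)

Lemma mx_entry_le_norm (R : realType) (m n : nat) (A : 'M[R]_(m, n)) i j :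
  `|A i j| <= `|A|.
Proof.
rewrite [leRHS]/Num.Def.normr/= mx_normrE.
exact: (le_bigmax _ (fun ij : 'I_m * 'I_n => `|A ij.1 ij.2|) (i, j)).
Qed.

Lemma mx_norm_le (R : realType) (m n : nat) (A : 'M[R]_(m, n)) (c : R) :
  0 <= c -> (forall i j, `|A i j| <= c) -> `|A| <= c.
Proof.
move=> c0 Ac; rewrite [leLHS]/Num.Def.normr/= mx_normrE.
by apply: bigmax_le => // -[i j] _; exact: Ac.
Qed.

Lemma mx_norm_tr (R : realType) (m n : nat) (A : 'M[R]_(m, n)) : `|A^T| = `|A|.
Proof.
apply/eqP; rewrite eq_le; apply/andP; split.
  by apply: mx_norm_le => // i j; rewrite mxE mx_entry_le_norm.
by apply: mx_norm_le => // i j; have := mx_entry_le_norm A^T j i; rewrite mxE.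
Qed.

(** The norm of matrices is the maximum norm, which is submultiplicative only up
    to the inner dimension. *)
Lemma mx_norm_mul (R : realType) (m n p : nat) (A : 'M[R]_(m, n))
  (B : 'M[R]_(n, p)) : `|A *m B| <= n%:R * (`|A| * `|B|).
Proof.
apply: mx_norm_le => [|i j]; first by rewrite !mulr_ge0.
rewrite mxE (le_trans (ler_norm_sum _ _ _))//.
rewrite (@le_trans _ _ (\sum_(k < n) `|A| * `|B|))//.
  by apply: ler_sum => k _; rewrite normrM ler_pM// mx_entry_le_norm.
by rewrite sumr_const card_ord mulr_natl.
Qed.

Lemma cvg_mx (R : realType) (T : topologicalType) (m n : nat)
    (F : T -> 'M[R]_(m, n)) (x : T) :
  (forall i j, F y i j @[y --> x] --> F x i j) -> F y @[y --> x] --> F x.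
Proof.
move=> Fij s /nbhs_ballP[e /= e0 es].
have : \forall y \near x, forall i j, ball (F x i j) e (F y i j).
  apply: filter_forall => i; apply: filter_forall => j.
  exact: (Fij i j _ (nbhsx_ballx _ _ e0)).
by apply: filterS => y Fy; apply: es.
Qed.

Lemma continuous_mulmx (R : realType) (T : topologicalType) (m n p : nat)
    (F : T -> 'M[R]_(m, n)) (G : T -> 'M[R]_(n, p)) :
  continuous F -> continuous G -> continuous (fun x => F x *m G x).
Proof.
move=> Fc Gc x; apply: cvg_mx => i j.
rewrite mxE; under eq_fun do rewrite mxE.
apply: cvg_big => [|k _]; first exact: add_continuous.
apply: cvgM.
  exact: cvg_comp (Fc x) (@coord_continuous _ _ _ _ _ (F x)).
exact: cvg_comp (Gc x) (@coord_continuous _ _ _ _ _ (G x)).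
Qed.

Lemma continuous_trmx (R : realType) (T : topologicalType) (m n : nat)
    (F : T -> 'M[R]_(m, n)) :
  continuous F -> continuous (fun x => (F x)^T).
Proof.
move=> Fc x; apply: cvg_mx => i j.
rewrite mxE; under eq_fun do rewrite mxE.
exact: cvg_comp (Fc x) (@coord_continuous _ _ _ _ _ (F x)).
Qed.

(** Heine-Borel is applied to row vectors, on which transposition is an
    isometry.  The sphere is empty in dimension 0, where any bound will do. *)
Lemma sphere_compact_lower_bound (R : realType) (n : nat) (f : 'cV[R]_n -> R) :
  continuous f -> (forall u, `|u| = 1 -> 0 < f u) ->
  exists2 c, 0 < c & forall u, `|u| = 1 -> c <= f u.
Proof.
move=> fc fpos; pose S : set 'rV[R]_n := [set v | `|v| = 1].
have [S0|/set0P S0] := eqVneq S set0.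
  exists 1 => // u u1; suff : S u^T by rewrite S0.
  by rewrite /S/= mx_norm_tr.
have trc : continuous (fun v : 'rV[R]_n => v^T).
  by apply: continuous_trmx => v; exact: cvg_id.
have Sc : compact S.
  apply: bounded_closed_compact.
    by exists 1; split=> // M M1 v; rewrite /S/= => ->; exact: ltW.
  rewrite (_ : S = (fun v : 'rV[R]_n => `|v|) @^-1` [set 1])//.
  apply: preimage_closed; last exact: closed_eq.
  by move=> v _; exact: norm_continuous.
have [|c cS cmin] := @EVT_min_rV R n (fun v => f v^T) S S0 Sc.
  apply: continuous_subspaceT => v.
  by apply: continuous_comp; [exact: trc|exact: fc].
exists (f c^T) => [|u u1].
  by apply: fpos; rewrite mx_norm_tr; move: cS; rewrite inE.
by rewrite -[u]trmxK; apply: cmin; rewrite inE /S/= mx_norm_tr.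
Qed.

(** * Twice differentiable functions *)

(** This is weaker than twice continuously differentiable: Taylor's formula with
    a little-o remainder asks no more, and it is easily propagated through sums
    and products. *)
Definition twice_diff (R : realType) (n : nat) (f : 'cV[R]_n -> R) : Prop :=
  (forall x, differentiable f x) /\
  (forall k x, differentiable (partial f k) x).

Definition gradient (R : realType) (n : nat) (f : 'cV[R]_n -> R)
    (x : 'cV[R]_n) : 'rV[R]_n :=
  \row_k partial f k x.

Definition hessian_at (R : realType) (n : nat) (f : 'cV[R]_n -> R)
    (x : 'cV[R]_n) : 'M[R]_n :=
  \matrix_(k, l) partial (partial f l) k x.

Lemma twice_diff_cst (R : realType) (n : nat) (c : R) :
  twice_diff (fun _ : 'cV[R]_n => c).
Proof.
split=> [x|k x]; first exact: differentiable_cst.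
rewrite (_ : partial _ k = fun=> 0); first exact: differentiable_cst.
by apply/funext => y; exact: derive_cst.
Qed.

Lemma twice_diffD (R : realType) (n : nat) (f g : 'cV[R]_n -> R) :
  twice_diff f -> twice_diff g -> twice_diff (fun x => f x + g x).
Proof.
move=> [df ddf] [dg ddg]; split=> [x|k x]; first exact: differentiableD.
rewrite (_ : partial _ k = partial f k + partial g k).
  exact: differentiableD.
by apply/funext => y; apply: deriveD; exact: diff_derivable.
Qed.

Lemma twice_diffM (R : realType) (n : nat) (f g : 'cV[R]_n -> R) :
  twice_diff f -> twice_diff g -> twice_diff (fun x => f x * g x).
Proof.
move=> [df ddf] [dg ddg]; split=> [x|k x]; first exact: differentiableM.
rewrite (_ : partial _ k = f * partial g k + g * partial f k).
  by apply: differentiableD; exact: differentiableM.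
by apply/funext => y; apply: deriveM; exact: diff_derivable.
Qed.

Lemma twice_diff_sum (R : realType) (n : nat) (I : Type) (s : seq I)
    (f : I -> 'cV[R]_n -> R) :
  (forall i, twice_diff (f i)) -> twice_diff (fun x => \sum_(i <- s) f i x).
Proof.
move=> df; elim: s => [|i s ih].
  by under eq_fun do rewrite big_nil; exact: twice_diff_cst.
by under eq_fun do rewrite big_cons; exact: twice_diffD.
Qed.

Lemma partial_comp_coord (R : realType) (n : nat) (h h' : R -> R) (c k : 'I_n)
    (x : 'cV[R]_n) : (forall t : R, is_derive t 1 h (h' t)) ->
  differentiable (fun y : 'cV[R]_n => h (y c 0)) x /\
  partial (fun y : 'cV[R]_n => h (y c 0)) k x = h' (x c 0) * (k == c)%:R.
Proof.
move=> dh; pose p (y : 'cV[R]_n) : R := y c 0.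
have dp : differentiable p x by exact: differentiable_coord.
have dhx : differentiable h (p x) by apply/derivable1_diffP.
split; first exact: (differentiable_comp dp dhx).
rewrite /partial deriveE; last exact: (differentiable_comp dp dhx).
rewrite (diff_comp dp dhx)/= -(deriveE _ dp).
have -> : 'D_(delta_mx k 0) p x = (k == c)%:R.
  have := derive_mx (@derivable_id R 'cV[R]_n x (delta_mx k 0)).
  rewrite derive_id => /matrixP/(_ c 0); rewrite !mxE eqxx andbT eq_sym.
  by move/esym.
rewrite diff1E//.
by rewrite derive1E derive_val [LHS]mulrC.
Qed.

(** Sine and cosine have to be treated together, each being the derivative of
    the other up to sign. *)
Lemma twice_diff_trig (R : realType) (n : nat) (c : 'I_n) :
  twice_diff (fun x : 'cV[R]_n => cos (x c 0)) /\
  twice_diff (fun x : 'cV[R]_n => sin (x c 0)).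
Proof.
have dcos k x := partial_comp_coord c k x (@is_derive_cos R).
have dsin k x := partial_comp_coord c k x (@is_derive_sin R).
split; split=> [x|k x].
- exact: (dcos c x).1.
- rewrite (_ : partial _ k = (cst (- (k == c)%:R)) * (fun x => sin (x c 0))).
    apply: differentiableM; last exact: (dsin k x).1.
    exact: differentiable_cst.
  by apply/funext => y; rewrite (dcos k y).2 mulrC mulrN -mulNr.
- exact: (dsin c x).1.
- rewrite (_ : partial _ k = (cst (k == c)%:R) * (fun x => cos (x c 0))).
    apply: differentiableM; last exact: (dcos k x).1.
    exact: differentiable_cst.
  by apply/funext => y; rewrite (dsin k y).2 mulrC.
Qed.

(** * Second-order Taylor expansion *)

Lemma derive_gradient (R : realType) (n : nat) (f : 'cV[R]_n -> R) x u :
  differentiable f x -> 'D_u f x = (gradient f x *m u) 0 0.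
Proof.
move=> df; rewrite deriveE// {1}[u]matrix_sum_delta linear_sum mxE/=.
apply: eq_bigr => k _; rewrite big_ord1 linearZ/= mxE /partial deriveE//.
by rewrite mulrC.
Qed.

(** The gradient is itself differentiable; its linear part at [a] is the
    Hessian. *)
Lemma gradient_expansion (R : realType) (n : nat) (f : 'cV[R]_n -> R) a
    (e : R) :
  twice_diff f -> 0 < e ->
  \forall u \near (0 : 'cV[R]_n),
    `|gradient f (a + u) - gradient f a - u^T *m hessian_at f a| <= e * `|u|.
Proof.
move=> [_ ddf] e0.
have near_entry l : \forall u \near (0 : 'cV[R]_n),
    `|partial f l (a + u) - partial f l a - (u^T *m hessian_at f a) 0 l|
      <= e * `|u|.
  have := diff_locallyxC (ddf l a); set k := the_littleo _ _ _ _ _ => expand.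
  have := littleoP [littleo of k] e0.
  apply: filterS => u; rewrite expand.
  suff -> : (u^T *m hessian_at f a) 0 l = 'd (partial f l) a u.
    have cancel (x y z : R) : x + y + z - x - y = z by ring.
    by rewrite cancel.
  rewrite -deriveE// derive_gradient// !mxE.
  by apply: eq_bigr => i _; rewrite !mxE mulrC.
have : \forall u \near (0 : 'cV[R]_n), forall l,
    `|partial f l (a + u) - partial f l a - (u^T *m hessian_at f a) 0 l|
      <= e * `|u|.
  exact: (@filter_forall _ _ _ _ (nbhs_filter (0 : 'cV[R]_n))).
apply: filterS => u entry; apply: mx_norm_le => [|i l].
  by rewrite mulr_ge0// ltW.
by have := entry l; rewrite ord1 !mxE.
Qed.

Lemma is_derive_line (R : realType) (V : normedModType R) (f : V -> R) a u
    (t : R) :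
  differentiable f (a + t *: u) ->
  is_derive t 1 (fun s : R => f (a + s *: u)) ('D_u f (a + t *: u)).
Proof.
move=> df; have quotE :
    (fun h : R => h^-1 *: (((fun s : R => f (a + s *: u)) \o shift t) (h *: 1)
                          - f (a + t *: u))) =
    (fun h : R => h^-1 *: ((f \o shift (a + t *: u)) (h *: u)
                          - f (a + t *: u))).
  apply/funext => h /=; rewrite [h *: 1]mulr1 scalerDl.
  by rewrite [X in f X]addrCA.
apply: DeriveDef; rewrite ?/derivable ?/derive quotE//.
exact: diff_derivable.
Qed.

(** The mean value theorem on the segment from [a] to [a + u] reduces the error
    to an increment of the gradient, which [gradient_expansion] controls. *)
Lemma taylor2 (R : realType) (n : nat) (f : 'cV[R]_n -> R) a (e : R) :
  twice_diff f -> 0 < e ->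
  \forall u \near (0 : 'cV[R]_n),
    `|f (a + u) - f a - (gradient f a *m u) 0 0
        - 2^-1 * (u^T *m hessian_at f a *m u) 0 0| <= e * `|u| ^+ 2.
Proof.
move=> ddf e0.
(* The factor n is lost in [mx_norm_mul]; n.+1 avoids dividing by zero. *)
pose e' := e / n.+1%:R.
have e'0 : 0 < e' by rewrite divr_gt0.
have /nbhs_normP[d /= d0 grad_le] := gradient_expansion a ddf e'0.
apply/nbhs_normP; exists d => //= u; rewrite /ball_ /= sub0r normrN => ud.
set g := (gradient f a *m u) 0 0; set q := (u^T *m hessian_at f a *m u) 0 0.
pose phi (t : R) := f (a + t *: u) - t * g - t ^+ 2 * (2^-1 * q).
pose dphi (t : R) := (gradient f (a + t *: u) *m u) 0 0 - g - t * q.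
have dphiP (t : R) : is_derive t 1 phi (dphi t).
  have dl := is_derive_line (ddf.1 (a + t *: u)).
  rewrite [X in is_derive _ _ X](_ : _ = (fun s : R => f (a + s *: u)) -
     g *: (id : R -> R) - (2^-1 * q) *: ((id : R -> R) ^+ 2)); last first.
    by apply/funext => s; rewrite /phi mulrC [_ * (2^-1 * q)]mulrC.
  apply: is_derive_eq; rewrite derive_gradient; last exact: ddf.1.
  rewrite -[g *: _]/(g * 1).
  rewrite -[(2^-1 * q) *: _]/(2^-1 * q * (2 * t ^+ 1 * 1)) /dphi.
  by field.
have phi_cont : {within `[0, 1], continuous phi}.
  apply: derivable_within_continuous => t _.
  by have [] := dphiP t.
have [t /itvP t01] := MVT ltr01 (fun t _ => dphiP t) phi_cont.
rewrite /phi scale1r scale0r addr0 !mul1r !mul0r expr1n expr0n mul1r mul0r.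
rewrite !subr0 mulr1 => phiE.
have -> : f (a + u) - f a - g - 2^-1 * q = dphi t by rewrite -phiE; ring.
have dphiE : dphi t = ((gradient f (a + t *: u) - gradient f a
                        - (t *: u)^T *m hessian_at f a) *m u) 0 0.
  have -> : (t *: u)^T = t *: u^T by apply/matrixP => i j; rewrite !mxE.
  rewrite /dphi /g /q !mulmxBl -!scalemxAl.
  by move: (_ *m u) (_ *m u) (_ *m u) => A B C; rewrite !mxE.
have tu : `|t *: u| <= `|u|.
  by rewrite normrZ ger0_norm ?t01// ler_piMl// t01.
have /grad_le grad_tu : ball_ Num.Def.normr 0 d (t *: u).
  by rewrite /ball_/= sub0r normrN (le_lt_trans tu).
rewrite dphiE (le_trans (mx_entry_le_norm _ _ _))//.
rewrite (le_trans (mx_norm_mul _ _))//.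
have -> : e * `|u| ^+ 2 = n.+1%:R * (e' * `|u| * `|u|).
  by rewrite -mulrA mulrA [_ * e']mulrC divfK ?pnatr_eq0// expr2.
rewrite ler_pM ?mulr_ge0 ?ler_nat// ler_wpM2r// (le_trans grad_tu)//.
by rewrite ler_wpM2l// ltW.
Qed.

(** * Isolated points of a level set *)

Definition quad_map (R : realType) (m n : nat) (H : 'I_m -> 'M[R]_n)
    (u : 'cV[R]_n) : 'cV[R]_m :=
  \col_i (u^T *m H i *m u) 0 0.

(** The two conditions defining a flex in the direction [r], namely [M r = 0] and
    [q r] in the image of [M], are measured by one continuous function [phi], in
    which the columns of [N] are the linear equations of the image of [M].  It
    is bounded below on the unit sphere, whereas the expansion makes it small at
    the direction of any small [u] with [G (a + u) = G a]. *)
Lemma quadratic_isolation (R : realType) (m n : nat) (G : 'cV[R]_n -> 'cV[R]_m)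
    (a : 'cV[R]_n) (M : 'M[R]_(m, n)) (H : 'I_m -> 'M[R]_n) :
  (forall e, 0 < e -> \forall u \near (0 : 'cV[R]_n),
     `|G (a + u) - G a - M *m u - 2^-1 *: quad_map H u| <= e * `|u| ^+ 2) ->
  (forall r1 r2 : 'cV[R]_n, M *m r1 = 0 -> quad_map H r1 + M *m r2 = 0 ->
     r1 = 0) ->
  \forall u \near (0 : 'cV[R]_n), G (a + u) = G a -> u = 0.
Proof.
move=> expand noflex; pose N := cokermx M^T.
pose phi u := `|M *m u| + `|(quad_map H u)^T *m N|.
have [c c0 phi_ge] : exists2 c, 0 < c & forall u, `|u| = 1 -> c <= phi u.
  apply: sphere_compact_lower_bound.
    have qc : continuous (quad_map H).
      move=> u; apply: cvg_mx => i j; rewrite mxE; under eq_fun do rewrite mxE.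
      suff : continuous (fun u : 'cV[R]_n => u^T *m H i *m u).
        by move=> /(_ u)Fc; exact: cvg_comp Fc (@coord_continuous _ _ _ _ _ _).
      apply: continuous_mulmx; last by move=> ?; exact: cvg_id.
      apply: continuous_mulmx; last by move=> ?; exact: cst_continuous.
      by apply: continuous_trmx => ?; exact: cvg_id.
    have Mc : continuous (fun u : 'cV[R]_n => M *m u).
      apply: continuous_mulmx; first by move=> ?; exact: cst_continuous.
      by move=> ?; exact: cvg_id.
    have qNc : continuous (fun u => (quad_map H u)^T *m N).
      apply: continuous_mulmx; first exact: continuous_trmx.
      by move=> ?; exact: cst_continuous.
    move=> u; exact: cvgD (cvg_norm (Mc u)) (cvg_norm (qNc u)).
  move=> u u1; rewrite lt_def addr_ge0// andbT.
  apply: contra_eqN u1; rewrite /phi paddr_eq0// !normr_eq0.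
  move=> /andP[/eqP Mu /eqP qN].
  have /submxP[D qE] : ((quad_map H u)^T <= M^T)%MS by rewrite submxE qN.
  rewrite (noflex u (- D^T))// ?normr0 1?eq_sym ?oner_eq0//.
  by rewrite mulmxN -[M]trmxK -trmx_mul -qE trmxK subrr.
have quad_le u : `|quad_map H u| <= (\sum_i n%:R * (n%:R * `|H i|)) * `|u| ^+ 2.
  apply: mx_norm_le => [|i j].
    by rewrite mulr_ge0// ?exprn_ge0// sumr_ge0.
  rewrite mxE (le_trans (mx_entry_le_norm _ _ _))//.
  rewrite (le_trans (mx_norm_mul _ _))//.
  rewrite (@le_trans _ _ (n%:R * (n%:R * `|H i|) * `|u| ^+ 2))//.
    have := mx_norm_mul u^T (H i); rewrite mx_norm_tr => uH.
    have -> : n%:R * (n%:R * `|H i|) * `|u| ^+ 2 =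
              n%:R * (n%:R * (`|u| * `|H i|) * `|u|) by ring.
    by rewrite ler_wpM2l// ler_wpM2r.
  rewrite ler_wpM2r ?exprn_ge0// (bigD1 i)//= lerDl.
  by rewrite sumr_ge0// => k _; rewrite !mulr_ge0.
set K := \sum_i _ in quad_le.
have K0 : 0 <= K by rewrite sumr_ge0// => i _; rewrite !mulr_ge0.
(* This precision makes the second term of [phi] at most c / 2. *)
pose e := c / (4 * (m%:R * `|N|) + 4).
have D0 : 0 < 4 * (m%:R * `|N|) + 4.
  by rewrite ltr_wpDl// !mulr_ge0.
have e0 : 0 < e by rewrite divr_gt0.
have u_small : \forall u \near (0 : 'cV[R]_n), `|u| * (2^-1 * K + e) < c / 2.
  have Ke : 0 < 2^-1 * K + e by rewrite ltr_wpDl// mulr_ge0.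
  apply/nbhs_normP; exists (c / 2 / (2^-1 * K + e)) => /=.
    by rewrite !divr_gt0.
  by move=> u; rewrite /ball_/= sub0r normrN ltr_pdivlMr.
have := expand e e0.
apply: filterS2 u_small => u us ue Gu; apply/eqP/negPn/negP => u0.
set E := (X in `|X|) in ue.
have MuE : M *m u = - E - 2^-1 *: quad_map H u.
  by rewrite /E Gu subrr sub0r opprD !opprK addrK.
(* [N] kills the image of [M], so only the remainder [E] is left. *)
have qNE : (quad_map H u)^T *m N = - 2 *: (E^T *m N).
  have := congr1 (fun A => A^T *m N) MuE.
  have -> : (- E - 2^-1 *: quad_map H u)^T = - E^T - 2^-1 *: (quad_map H u)^T.
    by apply/matrixP => i j; rewrite !mxE.
  rewrite trmx_mul -mulmxA mulmx_coker mulmx0 mulmxBl mulNmx -scalemxAl.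
  move=> /esym/eqP; rewrite subr_eq0 eq_sym => /eqP /(congr1 ( *:%R 2)).
  by rewrite scalerA divff ?pnatr_eq0// scale1r scalerN scaleNr.
have MuB : `|M *m u| <= (2^-1 * K + e) * `|u| ^+ 2.
  rewrite MuE (le_trans (ler_normB _ _))// normrN normrZ ger0_norm//.
  by rewrite mulrDl addrC lerD// -mulrA ler_wpM2l.
have qNB : `|(quad_map H u)^T *m N| <= c / 2 * `|u| ^+ 2.
  rewrite qNE normrZ normrN ger0_norm//.
  rewrite (@le_trans _ _ (2 * (m%:R * (e * `|u| ^+ 2 * `|N|))))//.
    rewrite ler_wpM2l// (le_trans (mx_norm_mul _ _))// ler_wpM2l//.
    by rewrite mx_norm_tr ler_wpM2r.
  have -> : 2 * (m%:R * (e * `|u| ^+ 2 * `|N|)) =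
            2 * (m%:R * `|N|) * e * `|u| ^+ 2 by ring.
  rewrite ler_wpM2r ?exprn_ge0//.
  have -> : c = e * (4 * (m%:R * `|N|) + 4) by rewrite divfK// gt_eqF.
  have : 0 <= m%:R * `|N| by rewrite mulr_ge0.
  by move: (m%:R * `|N|) => y y0; lra.
have u_pos : 0 < `|u| by rewrite normr_gt0.
have /phi_ge : `| `|u|^-1 *: u| = 1.
  by rewrite normrZ normfV normr_id mulVf ?normr_eq0.
(* [phi] is not homogeneous: its two terms have degrees 1 and 2. *)
have phiE : phi (`|u|^-1 *: u) =
    (`|u| * `|M *m u| + `|(quad_map H u)^T *m N|) / `|u| ^+ 2.
  rewrite /phi -scalemxAr normrZ normfV normr_id.
  have -> : quad_map H (`|u|^-1 *: u) = `|u| ^- 2 *: quad_map H u.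
    apply/colP => i; rewrite mxE [RHS]mxE [X in _ = _ * X]mxE.
    have -> : (`|u|^-1 *: u)^T = `|u|^-1 *: u^T.
      by apply/matrixP => ? ?; rewrite !mxE.
    by rewrite -!scalemxAl -scalemxAr scalerA mxE -invfM.
  have -> : (`|u| ^- 2 *: quad_map H u)^T = `|u| ^- 2 *: (quad_map H u)^T.
    by apply/matrixP => ? ?; rewrite !mxE.
  rewrite -scalemxAl normrZ normfV normrX normr_id.
  by field; rewrite gt_eqF.
rewrite phiE ler_pdivlMr ?exprn_gt0//; apply/negP; rewrite -ltNge.
rewrite (_ : c * _ = c / 2 * `|u| ^+ 2 + c / 2 * `|u| ^+ 2); last by field.
apply: ltr_leD => //.
apply: (@le_lt_trans _ _ (`|u| * (2^-1 * K + e) * `|u| ^+ 2)).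
  by rewrite -[leRHS]mulrA ler_wpM2l.
by rewrite ltr_pM2r// exprn_gt0.
Qed.

(** * The constraint map *)

Definition twice_diff_mx (R : realType) (n p q : nat)
    (F : 'cV[R]_n -> 'M[R]_(p, q)) : Prop :=
  forall i j, twice_diff (fun x => F x i j).

Lemma twice_diff_mx_cst (R : realType) (n p q : nat) (A : 'M[R]_(p, q)) :
  twice_diff_mx (fun _ : 'cV[R]_n => A).
Proof. by move=> i j; exact: twice_diff_cst. Qed.

Lemma twice_diff_mulmx (R : realType) (n p q r : nat)
    (F : 'cV[R]_n -> 'M[R]_(p, q)) (G : 'cV[R]_n -> 'M[R]_(q, r)) :
  twice_diff_mx F -> twice_diff_mx G -> twice_diff_mx (fun x => F x *m G x).
Proof.
move=> dF dG i j; under eq_fun do rewrite mxE.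
by apply: twice_diff_sum => k; apply: twice_diffM; [exact: dF|exact: dG].
Qed.

Lemma twice_diff_mulmx_big (R : realType) (n p : nat) (I : Type) (s : seq I)
    (F : I -> 'cV[R]_n -> 'M[R]_p) :
  (forall i, twice_diff_mx (F i)) ->
  twice_diff_mx (fun x => \big[mulmx/1%:M]_(i <- s) F i x).
Proof.
move=> dF; elim: s => [|i s ih].
  by under eq_fun do rewrite big_nil; exact: twice_diff_mx_cst.
by under eq_fun do rewrite big_cons; exact: twice_diff_mulmx.
Qed.

Lemma twice_diff_Rx (R : realType) (n : nat) (c : 'I_n) :
  twice_diff_mx (fun x : 'cV[R]_n => Rx (x c 0)).
Proof.
have [dcos dsin] := @twice_diff_trig R n c.
have dnsin : twice_diff (fun x : 'cV[R]_n => - sin (x c 0)).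
  under eq_fun do rewrite -mulN1r.
  by apply: twice_diffM => //; exact: twice_diff_cst.
move=> i j; under eq_fun do rewrite mxE.
case: i => [[|[|[|//]]] ?]; case: j => [[|[|[|//]]] ?] //=;
  exact: twice_diff_cst.
Qed.

Lemma twice_diff_hom_rot (R : realType) (n : nat) (Q : 'cV[R]_n -> 'M[R]_3) :
  twice_diff_mx Q -> twice_diff_mx (fun x => Defs.hom (Q x) 0).
Proof.
move=> dQ i j; under eq_fun do rewrite mxE.
case: splitP => i' _; under eq_fun do rewrite mxE; case: splitP => j' _ //;
  exact: twice_diff_cst.
Qed.

Lemma twice_diff_constraint_map (R : realType) (O : rigid_origami R)
    (i : 'I_(n_constraints O)) :
  twice_diff (fun x => constraint_map x i 0).
Proof.
have dvertex v : twice_diff_mx (fun x => vertex_loop_global (O := O) x v).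
  apply: twice_diff_mulmx; last exact: twice_diff_mx_cst.
  apply: twice_diff_mulmx; first exact: twice_diff_mx_cst.
  apply: twice_diff_mulmx_big => j.
  by apply: twice_diff_mulmx; [exact: twice_diff_mx_cst|exact: twice_diff_Rx].
have dhole h : twice_diff_mx (fun x => hole_loop_global (O := O) x h).
  apply: twice_diff_mulmx; last exact: twice_diff_mx_cst.
  apply: twice_diff_mulmx; first exact: twice_diff_mx_cst.
  apply: twice_diff_mulmx_big => j.
  apply: twice_diff_mulmx; first exact: twice_diff_mx_cst.
  by apply: twice_diff_hom_rot; exact: twice_diff_Rx.
under eq_fun do rewrite mxE.
under eq_fun do rewrite mxE.
case: splitP => k _.
  case/mxvec_indexP: k => v k; under eq_fun do rewrite mxvecE mxE.
  by case: k => [[|[|[|//]]] ?]; exact: dvertex.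
case/mxvec_indexP: k => h k; under eq_fun do rewrite mxvecE mxE.
case: k => [[|[|[|[|[|[|//]]]]]] ?] /=;
  by under eq_fun do rewrite mxE mxE; exact: dhole.
Qed.

(** * Static rigidity, prestress stability and second-order rigidity *)

Lemma sqmx_gt0 (R : realType) (n : nat) (y : 'cV[R]_n) :
  y != 0 -> 0 < (y^T *m y) 0 0.
Proof.
move=> y0; rewrite mxE lt_def; apply/andP; split; last first.
  by apply: sumr_ge0 => i _; rewrite mxE -expr2 sqr_ge0.
apply: contra y0 => /eqP; under eq_bigr do rewrite mxE -expr2.
move=> /psumr_eq0P s0; apply/eqP/colP => i.
by apply/eqP; rewrite mxE -sqrf_eq0 s0// => j _; exact: sqr_ge0.
Qed.

(** The identity and the zero stress are enough, since [M^T M] is positive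
    definite when [M] is injective. *)
Lemma first_order_prestress (R : realType) (O : rigid_origami R) :
  first_order_rigid O -> prestress_stable O.
Proof.
move=> inj; exists 1%:M, 0; rewrite mul0mx mulmx1.
have -> : stress_hessian (0 : 'rV_(n_constraints O)) = 0.
  by rewrite /stress_hessian big1// => i _; rewrite mxE scale0r.
split=> //; split.
- exact: trmx1.
- by move=> x x0; rewrite mulmx1 sqmx_gt0.
- by rewrite addr0 trmx_mul trmxK.
- move=> x x0; rewrite addr0 mulmxA -trmx_mul -mulmxA sqmx_gt0//.
  by apply: contra x0 => /eqP/inj ->.
Qed.

(** If every coordinate form is a combination of rows of [M], then [M r]
    determines each coordinate of [r]. *)
Lemma statically_first_order (R : realType) (O : rigid_origami R) :
  statically_rigid O -> first_order_rigid O.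
Proof.
move=> stat r Mr0; apply/colP => k; have [w wM] := stat (delta_mx 0 k).
have := congr1 (mulmx w) Mr0; rewrite mulmxA wM mulmx0 => /matrixP/(_ 0 0).
by rewrite -rowE !mxE.
Qed.

(** Applying the self-stress [w] to the second equation of a flex removes [r2],
    so the stress part of [K] vanishes at [r1]; the elastic part vanishes there
    because [M r1 = 0]. *)
Lemma prestress_second_order (R : realType) (O : rigid_origami R) :
  prestress_stable O -> second_order_rigid O.
Proof.
move=> [B [w [_ wM0 [_ Kpos]]]] r1 r2 [Mr1 flex].
have wq0 : (r1^T *m stress_hessian w *m r1) 0 0 = 0.
  have := congr1 (mulmx w) flex.
  rewrite mulmxDr mulmxA wM0 mul0mx addr0 mulmx0 => /matrixP/(_ 0 0) wq.
  rewrite mxE [RHS]mxE in wq; rewrite -[RHS]wq /stress_hessian.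
  rewrite mulmx_sumr mulmx_suml summxE.
  by apply: eq_bigr => i _; rewrite -scalemxAr -scalemxAl !mxE.
apply/eqP/negPn/negP => /Kpos.
rewrite mulmxDr mulmxDl mxE wq0 addr0 -!mulmxA Mr1 !mulmx0 mxE.
by rewrite ltxx.
Qed.

(** * Second-order rigidity implies rigidity *)

(** The distance to the starting point vanishes at time 0 and is positive at
    some other time, so by the intermediate value theorem it takes all small
    positive values. *)
Lemma continuous_escape (R : realType) (V : normedModType R) (g : R -> V) :
  {within `[0, 1], continuous g} -> (exists2 t, 0 <= t <= 1 & g t != g 0) ->
  forall e, 0 < e -> exists2 t, 0 <= t <= 1 & 0 < `|g t - g 0| < e.
Proof.
move=> gc [t1 /andP[t10 t11] gt1] e e0.
pose h t := `|g t - g 0|.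
have h1 : 0 < h t1 by rewrite normr_gt0 subr_eq0.
have hc : {within `[0, t1], continuous h}.
  have gc' : {within `[0, t1], continuous g}.
    apply: continuous_subspaceW gc => s /=; rewrite !in_itv/= => /andP[-> st].
    exact: le_trans st t11.
  move=> s; apply: cvg_norm; apply: cvgB; first exact: gc'.
  exact: cst_continuous.
pose v := Num.min (h t1) e / 2.
have v0 : 0 < v by rewrite divr_gt0// lt_min h1 e0.
have m0 : 0 < Num.min (h t1) e by rewrite lt_min h1 e0.
have ve : v < e.
  have := ge_min e (h t1) e; rewrite lexx orbT => le_e.
  by apply: (lt_le_trans _ le_e); rewrite /v; lra.
have vh : v <= h t1.
  have := ge_min (h t1) (h t1) e; rewrite lexx => le_h.
  by apply: (le_trans _ le_h); rewrite /v; lra.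
have h0 : h 0 = 0 by rewrite /h subrr normr0.
have [|s] := IVT t10 hc (v := v).
  by rewrite h0 ge_min (ltW v0) le_max vh orbT.
rewrite in_itv/= => /andP[s0 st] hs; exists s; rewrite -/(h s) ?hs ?v0//.
by rewrite s0 (le_trans st).
Qed.

Lemma second_order_rigidity (R : realType) (O : rigid_origami R) :
  second_order_rigid O -> rigid O.
Proof.
move=> sor [g [gc g0 gok gmove]].
pose A i x := constraint_map (O := O) x i 0.
have isolated : \forall u \near (0 : 'cV[R]_(n_creases O)),
    constraint_map (O := O) (rho O + u) = constraint_map (rho O) -> u = 0.
  apply: (@quadratic_isolation _ _ _ (@constraint_map R O) (rho O)
    (rigidity_matrix O) (@hessian R O)).
  - move=> e e0.
    have : \forall u \near (0 : 'cV[R]_(n_creases O)), forall i,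
       `|constraint_map (rho O + u) i 0 - constraint_map (rho O) i 0
         - (gradient (A i) (rho O) *m u) 0 0
         - 2^-1 * (u^T *m hessian_at (A i) (rho O) *m u) 0 0|
       <= e * `|u| ^+ 2.
      apply: (@filter_forall _ _ _ _
        (nbhs_filter (0 : 'cV[R]_(n_creases O)))) => i.
      exact: taylor2 (twice_diff_constraint_map i) e0.
    apply: filterS => u ui; apply: mx_norm_le => [|i j].
      by rewrite mulr_ge0 ?exprn_ge0// ltW.
    have Mu : (rigidity_matrix O *m u) i 0 =
        (gradient (A i) (rho O) *m u) 0 0.
      rewrite mxE [RHS]mxE; apply: eq_bigr => k _.
      by rewrite [rigidity_matrix O i k]mxE [gradient _ _ _ _]mxE.
    have qu : quad_map (@hessian R O) u i 0 =
        (u^T *m hessian_at (A i) (rho O) *m u) 0 0.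
      by rewrite mxE.
    rewrite ord1; have := ui i; rewrite -Mu -qu.
    move: (constraint_map _) (constraint_map _) (_ *m u) (quad_map _ u).
    by move=> A1 A2 L Q; rewrite !mxE.
  - by move=> r1 r2 Mr1 flex; apply: (sor r1 r2); split.
have /nbhs_normP[d /= d0 isoball] := isolated.
have [t t01 /andP[gt0 gtd]] := continuous_escape gc gmove d0.
(* At a consistent state every loop matrix is the identity, so the constraint
   map has the same value at all of them. *)
have consistentE x : consistent x ->
    constraint_map (O := O) x = constraint_map (rho O).
  move=> [xv xh]; have [rv rh] := rho_consistent O; congr (row_mx _ _)^T.
    congr mxvec; apply/matrixP => v k; rewrite mxE [RHS]mxE.
    by rewrite /vertex_loop_global xv rv.
  congr mxvec; apply/matrixP => h k; rewrite mxE [RHS]mxE.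
  by rewrite /hole_loop_global xh rh.
have : g t - rho O = 0.
  apply: isoball; first by rewrite /ball_/= sub0r normrN -g0.
  by rewrite addrC subrK; apply: consistentE; have [] := gok t t01.
by move=> gt_rho; move: gt0; rewrite g0 gt_rho normr0 ltxx.
Qed.

Theorem theorem2 (R : realType) (O : rigid_origami R) :
  [/\ first_order_rigid O \/ statically_rigid O -> prestress_stable O,
      prestress_stable O -> second_order_rigid O &
      second_order_rigid O -> rigid O].
Proof.
split.
- by case=> [|/statically_first_order]; exact: first_order_prestress.
- exact: prestress_second_order.
- exact: second_order_rigidity.
Qed.
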